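(* Let $(W,S)$ be a finite Coxeter system, let $T=\bigcup_{w\in W}wSw^{-1}$, and let $S'\subseteq T$ be such that $(W,S')$ is a simple system (that is, a Coxeter system). Then the parabolic subgroups with respect to $S$ coincide with those with respect to $S'$.
   Context: For a Coxeter system $(W,S)$, a parabolic subgroup with respect to $S$ (parabolic in the classical sense) is a subgroup of $W$ generated by a conjugate $wIw^{-1}$ ($w\in W$) of a subset $I\subseteq S$. *)

(* Defs.v *)
From HB Require Import structures.
From mathcomp Require Import all_boot all_fingroup.
Set Implicit Arguments.
Unset Strict Implicit.
Unset Printing Implicit Defensive.

Local Open Scope group_scope.

(* MathComp's x ^ y and A :^ y conjugate on the right, A :^ y = y^-1 A y, so   *)
(* the conjugate w A w^-1 is A :^ w^-1.                                       *)

Section CoxeterSystem.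

Variable gT : finGroupType.
Implicit Types W S : {set gT}.

(* S consists of involutions and W has the presentation                       *)
(*   < S | (s t)^m(s,t) = 1 for s, t in S >,  m(s,t) the order of s t,        *)
(* i.e. S generates W, and any f from S to a possibly infinite group H that   *)
(* respects the relations extends to a homomorphism from W to H. The order of *)
(* s t is finite, so no pair (s, t) is excluded. The functions f and g are    *)
(* total on gT; only their values on S and on W, respectively, matter.        *)
Definition coxeter_system W S : Prop :=
  [/\ <<S>> = W,
      {in S, forall s, #[s] = 2}
    & forall (H : groupType) (f : gT -> H),
        {in S &, forall s t, (f s * f t) ^+ #[s * t] = 1} ->
      exists g : gT -> H,
        {in W &, {morph g : x y / x * y}} /\ {in S, g =1 f}].

Definition reflections W S : {set gT} := \bigcup_(w in W) S :^ w^-1.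

Definition parabolics W S : {set {group gT}} :=
  [set <<I :^ w^-1>>%G | w in W, I in powerset S].

End CoxeterSystem.

(* Main.v *)
Require Import Defs.
From HB Require Import structures.
From mathcomp Require Import all_boot all_fingroup.

(* Say that a parabolic generated by a conjugate of I has rank |I|. Two facts *)
(* on a single finite Coxeter system (W, S) with reflections T suffice:       *)
(*  - if W_I lies in a conjugate of W_J and |J| <= |I|, the two are equal;    *)
(*  - any k reflections lie in a parabolic of rank at most k.                 *)
(* Sign characters of W show that T is also the set of reflections of (W, S').*)
(* So an S'-parabolic P' of rank k lies in an S-parabolic P of rank at most   *)
(* k, which lies in an S'-parabolic P'' of rank at most k, and P' = P = P'' by*)
(* the first fact. The converse inclusion is symmetric.                       *)

Set Implicit Arguments.
Unset Strict Implicit.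
Unset Printing Implicit Defensive.

Local Open Scope group_scope.

(** Both facts rest on the inversion cocycle. The universal property extends the signed conjugations
    by generators to an action of [W]; its signs give sets [N w] with N(s) = {s} for s in S and
    N(xy) the symmetric difference of N(x) and x N(y) x^-1. These rules yield the exchange
    condition, the length [#|N w|] and minimal coset representatives. For the first fact
    ([parabolic_sub_eq]), a shortest element of a double coset carries I onto J. For the second,
    [parabolic_extend] absorbs one more reflection at the cost of at most one rank: the inversions
    of w_J w_0 are exactly the reflections outside W_J, and w_J w_0 is cut into steps of rank at
    most |J| + 1. *)

Section Involutions.

Variable gT : finGroupType.
Implicit Types r s t : gT.

(** * Products of two involutions *)

Lemma order2V s : #[s] = 2 -> s^-1 = s.
Proof. by move=> os; apply/eqP; rewrite eq_invg_mul -expg2 -os expg_order. Qed.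

Lemma dihedralM s t k : #[s] = 2 -> #[t] = 2 ->
  (s * t) ^- k * s = s * (s * t) ^+ k.
Proof.
move=> os ot; elim: k => [|k IHk]; first by rewrite !expg0 invg1 mulg1 mul1g.
rewrite [in LHS]expgSr invMg -mulgA IHk expgS !mulgA invMg mulgKV.
by rewrite -{2}(order2V os) mulVg mul1g order2V.
Qed.

Lemma dihedral_conj s t k : #[s] = 2 -> #[t] = 2 ->
  s ^ ((s * t) ^- k) = (s * t) ^+ k.*2 * s.
Proof.
move=> os ot; rewrite conjgE invgK -addnn expgD -!mulgA; congr (_ * _).
by apply: (mulIg ((s * t) ^+ k)); rewrite mulgKV -mulgA -dihedralM // mulKVg.
Qed.

Lemma odd_order_conj s t : #[s] = 2 -> #[t] = 2 -> odd #[s * t] ->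
  exists2 x, x \in <<[set s; t]>> & t = s ^ x.
Proof.
move=> os ot om; pose k := #[s * t]./2; set D := <<_>>.
have Ds : s \in D by rewrite mem_gen // !inE eqxx.
have Dt : t \in D by rewrite mem_gen // !inE eqxx orbT.
(* Writing m = 2k + 1 for the order of st, this conjugates s to (st)^(m-1) s = (st)^-1 s = t. *)
exists ((s * t) ^- k); first by rewrite groupV groupX ?groupM.
apply: (mulgI (s * t)); rewrite dihedral_conj // mulgA -expgS.
have -> : k.*2.+1 = #[s * t] by rewrite -[RHS]odd_double_half om.
rewrite expg_order mul1g.
by rewrite -mulgA -{2}(order2V ot) mulgV mulg1.
Qed.

End Involutions.

(** * The inversion cocycle of a Coxeter system *)

Section InversionCocycle.

Variables (gT : finGroupType).
Implicit Types (r s t x y w : gT) (S : {set gT}).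

Fact signed_conj_subproof s :
  injective (fun u : gT * bool => (u.1 ^ s, u.2 (+) (u.1 == s))).
Proof. by move=> [r e] [t f] /= [] /conjg_inj <- /addIb <-. Qed.

(** The classical action of a generator on T x {1, -1}, with all of [gT] in place of T so that it
    makes sense before W is fixed. *)
Definition signed_conj s : {perm gT * bool} := perm (@signed_conj_subproof s).

Lemma signed_conjM_exp s t k r e : #[s] = 2 -> #[t] = 2 ->
  ((signed_conj s * signed_conj t) ^+ k) (r, e) =
    (r ^ ((s * t) ^+ k),
     e (+) odd (\sum_(0 <= i < k.*2) (r == (s * t) ^+ i * s)%g)).
Proof.
move=> os ot; elim: k => [|k IHk].
  by rewrite !expg0 perm1 conjg1 big_geq //= addbF.
rewrite expgSr permM IHk permM !permE /= -!conjgM -expgSr doubleS.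
(* The two new terms, i = 2k and i = 2k + 1, are the sign changes made by the last s and the last t,
   pulled back along the conjugations before them. *)
rewrite 2?big_nat_recr //= !oddD !oddb !addbA.
congr (_, _ (+) _ (+) _).
  rewrite -(inj_eq (@conjg_inj _ ((s * t) ^- k))) -conjgM mulgV conjg1.
  by rewrite dihedral_conj.
rewrite -(inj_eq (@conjg_inj _ ((s * t) ^+ k * s)^-1)) -conjgM mulgV conjg1.
rewrite invMg (order2V os) conjgM.
have -> : t ^ s = s * t * s by rewrite conjgE order2V ?mulgA.
rewrite conjMg dihedral_conj // conjgE.
by rewrite (commuteV (commuteX k (commute_refl _))) mulKg mulgA -expgS.
Qed.

(* Over i < 2m each (s t)^i s is listed twice, so the signs cancel.           *)
Lemma signed_conj_braid s t : #[s] = 2 -> #[t] = 2 ->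
  (signed_conj s * signed_conj t) ^+ #[s * t] = 1.
Proof.
move=> os ot; apply/permP => -[r e].
rewrite signed_conjM_exp // perm1 expg_order conjg1 -addnn.
set m := #[s * t]; rewrite (big_cat_nat (leq0n m)) ?leq_addr //=.
rewrite -{2}[m]add0n big_addn addnK.
under [X in (_ + X)%N]eq_bigr do rewrite expgD expg_order mulg1.
by rewrite addnn odd_double addbF.
Qed.

(** The signed conjugations satisfy the Coxeter relations, so they extend to W; N w collects the t
    whose sign w reverses, and composing two signed permutations adds the sign changes. *)
Lemma inversions_exist (W : {group gT}) S : coxeter_system W S ->
  exists N : gT -> {set gT},
    {in S, forall s, N s = [set s]} /\
    {in W &, forall x y t, (t \in N (x * y)) = (t \in N x) (+) (t ^ x \in N y)}.
Proof.
case=> genS oS univ; have [|g [gM gS]] := univ _ signed_conj.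
  by move=> s t Ss St; rewrite signed_conj_braid ?oS.
have SW : {subset S <= W} by move=> s; rewrite -genS; apply: mem_gen.
(* Whether x reverses the sign at t does not depend on the incoming sign. *)
have gfst x : x \in W -> forall t e,
    g x (t, e) = (t ^ x, e (+) (g x (t, false)).2).
  have g1 : g 1 = 1.
    by apply: (mulgI (g 1)); rewrite -gM ?group1 // !mulg1.
  rewrite -genS => /gen_prodgP[n [c Sc ->]].
  elim: n c Sc => [|n IHn] c Sc t e.
    by rewrite big_ord0 g1 !perm1 conjg1 addbF.
  have Wc (i : 'I_n) : c (lift ord0 i) \in W by apply: SW.
  rewrite big_ord_recl gM ?group_prod ?SW //.
  rewrite gS ?Sc // !permM !permE /= IHn // conjgM.
  by rewrite [in RHS]IHn /= // addbA.
exists (fun w => [set t | (g w (t, false)).2]); split=> [s Ss | x y Wx Wy t].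
  by apply/setP => t; rewrite !inE gS // permE.
by rewrite !inE gM // permM gfst //= [in LHS]gfst.
Qed.

End InversionCocycle.

(** * Reflections and sign characters *)

Section SignCharacter.

Variable gT : finGroupType.
Implicit Types (W : {group gT}) (S A : {set gT}).

Lemma reflectionsP W S t :
  reflect (exists2 x, x \in W & t ^ x \in S) (t \in reflections W S).
Proof.
apply: (iffP bigcupP) => [[x Wx Sx] | [x Wx Sx]]; exists x => //.
  by rewrite -mem_conjgV.
by rewrite mem_conjgV.
Qed.

Lemma reflectionsJ W S t x : x \in W ->
  (t ^ x \in reflections W S) = (t \in reflections W S).
Proof.
move=> Wx; apply/reflectionsP/reflectionsP=> -[y Wy Sty].
  by exists (x * y); rewrite ?conjgM ?groupM.
by exists (x^-1 * y); rewrite -?conjgM ?mulKVg ?groupM ?groupV.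
Qed.

(* For a class C of reflections, the generators in C -> -1, the others -> 1   *)
(* extends to a character of W; it is trivial on any A disjoint from C.       *)
Lemma generating_reflections_meet_class W S A s :
    coxeter_system W S -> <<A>> = W -> A \subset reflections W S -> s \in S ->
  exists2 x, x \in W & s ^ x \in A.
Proof.
case=> genS oS univ genA /subsetP AT Ss; apply/exists_inP; apply: contraT.
rewrite negb_exists_in => /forall_inP sA.
have SW : {subset S <= W} by move=> r; rewrite -genS; apply: mem_gen.
pose z := tperm true false; have z2 : z ^+ 2 = 1 by rewrite expg2 tperm2.
have classE r t x : x \in W -> t = r ^ x -> (r \in s ^: W) = (t \in s ^: W).
  by move=> Wx ->; rewrite ![_ \in s ^: _]class_sym classGidl.
have [|g [gM gS]] := univ _ (fun r => if r \in s ^: W then z else 1).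
  (* If rt has odd order, r and t are conjugate and get the same value, of square 1; if it has even
     order, the square of any product of the two values is already 1. *)
  move=> r t Sr St; case: (boolP (odd #[r * t])) => [om | em].
    have [x Dx tE] := odd_order_conj (oS r Sr) (oS t St) om.
    have Wx : x \in W.
      by apply: subsetP Dx; rewrite gen_subG subUset !sub1set !SW.
    rewrite (classE _ _ _ Wx tE); case: ifP => _; last by rewrite mulg1 expg1n.
    by rewrite -expg2 z2 expg1n.
  rewrite -[#[_]]odd_double_half (negbTE em) add0n -muln2 mulnC expgM.
  by do 2!case: ifP => _; rewrite ?mulg1 ?mul1g -?expg2 ?z2 ?expg1n.
have g1 : g 1 = 1 by apply: (mulgI (g 1)); rewrite -gM ?group1 // !mulg1.
have gJ r x : r \in W -> x \in W -> g r = 1 -> g (r ^ x) = 1.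
  move=> Wr Wx gr1; rewrite conjgE !gM ?groupM ?groupV // gr1 mul1g.
  by rewrite -gM ?groupV // mulVg.
(* Each element of A is conjugate to a generator outside the class of s, so g kills A and hence W,
   against g s = z. *)
have gW x : x \in W -> g x = 1.
  rewrite -genA => /gen_prodgP[n [c Ac ->]].
  have Wc i : c i \in W by rewrite -genA mem_gen.
  elim: n c Ac Wc => [|n IHn] c Ac Wc; first by rewrite big_ord0.
  rewrite big_ord_recl gM ?group_prod // IHn // mulg1.
  have [y Wy Scy] := reflectionsP _ _ _ (AT _ (Ac ord0)).
  rewrite -[c ord0](conjgK y); apply: gJ; rewrite ?groupV ?groupJ // gS //.
  case: ifP => // /imsetP[u Wu cE]; have := sA (u * y^-1).
  by rewrite groupM ?groupV // conjgM -cE conjgK Ac => /(_ isT).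
have := gW s (SW s Ss); rewrite gS // class_refl => z1.
by have := tpermL true false; rewrite -/z z1 perm1.
Qed.

End SignCharacter.

(** * Inversions, exchange and length *)

Section Inversions.

Variables (gT : finGroupType) (W : {group gT}) (S : {set gT}).
(* N w stands for the inversions of w, the reflections t with                 *)
(* l(t w) < l(w). The length function is w |-> #|N w|.                        *)
Variable N : gT -> {set gT}.
Hypothesis genW : <<S>> = W.
Hypothesis oS : {in S, forall s, #[s] = 2}.
Hypothesis NS : {in S, forall s, N s = [set s]}.
Hypothesis NM :
  {in W &, forall x y t, (t \in N (x * y)) = (t \in N x) (+) (t ^ x \in N y)}.

Implicit Types (r s t u v w x y : gT) (I J K : {set gT}) (c : seq gT).

Lemma gens_sub : S \subset W.
Proof. by rewrite -genW subset_gen. Qed.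

Lemma gen_subW J : J \subset S -> <<J>> \subset W.
Proof. by move=> JS; rewrite gen_subG (subset_trans JS gens_sub). Qed.

Lemma gen_word J x : x \in <<J>> ->
  exists2 c, {subset c <= J} & x = \prod_(s <- c) s.
Proof.
case/gen_prodgP=> n [c Jc ->]; exists (codom c).
  by move=> _ /codomP[i ->].
by rewrite codomE big_map enumT [index_enum _]unlock.
Qed.

Lemma word_in J c : {subset c <= J} -> \prod_(s <- c) s \in <<J>>.
Proof.
by move=> Jc; rewrite big_seq group_prod // => s /Jc; apply: mem_gen.
Qed.

Lemma gensV s : s \in S -> s^-1 = s.
Proof. by move/oS/order2V. Qed.

Lemma conjg_self x : x ^ x = x.
Proof. by rewrite conjgE mulKg. Qed.

Lemma inversions1 : N 1 = set0.
Proof.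
apply/setP=> t; have := NM (group1 W) (group1 W) t.
by rewrite mulg1 conjg1 addbb inE.
Qed.

Lemma inversionsV x : x \in W -> N x^-1 = N x :^ x.
Proof.
move=> Wx; apply/setP=> t; have Wx' : x^-1 \in W by rewrite groupV.
have := NM Wx' Wx t; rewrite mulVg inversions1 inE mem_conjg.
by move/esym/negbT; rewrite negb_add => /eqP.
Qed.

Lemma inversions_gen_conj J x t : J \subset S -> x \in <<J>> -> t \in N x ->
  exists2 y, y \in <<J>> & t ^ y \in J.
Proof.
move=> JS /gen_word[c Jc ->]; elim: c Jc t => [|s c IHc] Jc t.
  by rewrite big_nil inversions1 inE.
have Js : s \in J by rewrite Jc ?mem_head.
have Jc' : {subset c <= J} by move=> r cr; rewrite Jc // inE cr orbT.
have Ss := subsetP JS _ Js; have Ws := subsetP gens_sub _ Ss.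
have Wc := subsetP (gen_subW JS) _ (word_in Jc').
rewrite big_cons NM // (NS Ss) inE.
have [-> _ | _ /= /(IHc Jc')[y Jy tyJ]] := eqP.
  by exists 1; rewrite ?group1 ?conjg1.
by exists (s * y); rewrite ?conjgM // groupM ?(mem_gen Js).
Qed.

Lemma inversions_sub_gen J x : J \subset S -> x \in <<J>> -> N x \subset <<J>>.
Proof.
move=> JS Jx; apply/subsetP=> t /(inversions_gen_conj JS Jx)[y Jy].
by move=> Jty; rewrite -(groupJr t Jy) mem_gen.
Qed.

Lemma inversions_refl x t : x \in W -> t \in N x -> t \in reflections W S.
Proof.
rewrite -genW => Wx /(inversions_gen_conj (subxx S) Wx)[y Wy Sty].
by apply/reflectionsP; exists y; rewrite // -genW.
Qed.

Lemma refl_inversion t : t \in reflections W S -> t \in N t.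
Proof.
case/reflectionsP=> x Wx; move sE: (t ^ x) => s Ss.
have {sE} tE : t = s ^ x^-1 by rewrite -sE conjgK.
have Ws := subsetP gens_sub _ Ss.
rewrite {2}tE conjgE invgK !NM ?groupM ?groupV // inversionsV // mem_conjg.
rewrite tE conjgKV conjg_self (NS Ss) set11.
by rewrite addbCA addbb.
Qed.

Lemma reflections_sub : reflections W S \subset W.
Proof.
apply/subsetP=> t /reflectionsP[x Wx /(subsetP gens_sub)].
by rewrite groupJr.
Qed.

(** By the cocycle rule, t must equal p s p^-1 for some prefix p of the word followed by a letter s;
    multiplying by t erases that letter. *)
Lemma deletion c t : {subset c <= S} -> t \in N (\prod_(s <- c) s) ->
  exists c', [/\ {subset c' <= c}, size c' < size c
               & t * \prod_(s <- c) s = \prod_(s <- c') s].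
Proof.
elim: c t => [|s c IHc] t Sc; first by rewrite big_nil inversions1 inE.
have Ss : s \in S by rewrite Sc ?mem_head.
have Sc' : {subset c <= S} by move=> r cr; rewrite Sc // inE cr orbT.
have Wc : \prod_(s <- c) s \in W by rewrite -genW word_in.
have Ws := subsetP gens_sub _ Ss.
rewrite !big_cons NM // (NS Ss) inE.
have [-> _ | _ /= /(IHc _ Sc')[c' [c'c ltc' tE]]] := eqP.
  exists c; split=> //= [r cr|]; first by rewrite inE cr orbT.
  by rewrite -{1}(gensV Ss) mulKg.
exists (s :: c'); split=> //= [r|].
  by rewrite !inE => /predU1P[->|/c'c->]; rewrite ?eqxx ?orbT.
by rewrite big_cons -tE conjgE !mulgA mulgV mul1g.
Qed.

(** If the first letter of a word is not an inversion of the product, it is one of the remaining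
    product, and deletion gives a shorter word still in J. *)
Lemma descent J x : J \subset S -> x \in <<J>> -> x != 1 ->
  exists2 s, s \in J & s \in N x.
Proof.
move=> JS /gen_word[c Jc ->]; have [n le_cn] := ubnP (size c).
elim: n c le_cn Jc => // n IHn [|s c] /= le_cn Jc.
  by rewrite big_nil eqxx.
have Js : s \in J by rewrite Jc ?mem_head.
have Jc' : {subset c <= J} by move=> r cr; rewrite Jc // inE cr orbT.
have Ss := subsetP JS _ Js; have Ws := subsetP gens_sub _ Ss.
have Wc := subsetP (gen_subW JS) _ (word_in Jc').
have Sc' : {subset c <= S} by move=> r /Jc'/(subsetP JS).
rewrite big_cons; have [Nsx | ] := boolP (s \in N (s * \prod_(r <- c) r)).
  by exists s.
rewrite NM // (NS Ss) set11 conjg_self /= negbK.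
case/(deletion Sc')=> c' [c'c ltc' ->].
by apply: IHn => [|r /c'c/Jc' //]; apply: leq_trans ltc' (ltnW le_cn).
Qed.

Lemma card_inversionsM_le x y : x \in W -> y \in W ->
  #|N (x * y)| <= #|N x| + #|N y|.
Proof.
move=> Wx Wy; rewrite -(cardJg (N y) x^-1).
apply: leq_trans (leq_card_setU _ _).
apply/subset_leq_card/subsetP=> t; rewrite NM // inE mem_conjgV.
by case: (t \in N x).
Qed.

Lemma card_inversionsM x y : x \in W -> y \in W ->
    (forall t, t \in N x -> t ^ x \notin N y) ->
  #|N (x * y)| = (#|N x| + #|N y|)%N.
Proof.
move=> Wx Wy dis; rewrite -(cardJg (N y) x^-1) -cardsUI.
rewrite (_ : _ :&: _ = set0) ?cards0 ?addn0; last first.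
  apply/setP=> t; rewrite !inE mem_conjgV.
  by case: (boolP (t \in N x)) => // /dis/negbTE.
apply/eq_card=> t; rewrite NM // inE mem_conjgV.
by case: (boolP (t \in N x)) => // /dis/negbTE ->.
Qed.

Lemma card_inversionsV x : x \in W -> #|N x^-1| = #|N x|.
Proof. by move=> Wx; rewrite inversionsV // cardJg. Qed.

Lemma descent_length s x : s \in S -> x \in W -> s \in N x ->
  #|N x| = #|N (s * x)|.+1.
Proof.
move=> Ss Wx Nsx; have Ws := subsetP gens_sub _ Ss.
rewrite -{1}(mulKg s x) (gensV Ss) [LHS]card_inversionsM ?groupM //.
  by rewrite (NS Ss) cards1.
move=> t; rewrite (NS Ss) inE => /eqP->.
by rewrite conjg_self NM // (NS Ss) set11 conjg_self Nsx.
Qed.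

Lemma inversions0 x : x \in W -> N x = set0 -> x = 1.
Proof.
rewrite -genW => Wx Nx0; apply/eqP/contraT.
by case/(descent (subxx S) Wx)=> s; rewrite Nx0 inE.
Qed.

(** Stripping off descents one by one; with [card_inversions_word] this makes [#|N x|] the word
    length. *)
Lemma reduced_word x : x \in W ->
  exists c, [/\ {subset c <= S}, x = \prod_(s <- c) s & size c = #|N x|].
Proof.
have [n] := ubnP #|N x|; elim: n x => // n IHn x lexn Wx.
have [-> | ntx] := eqVneq x 1.
  by exists [::]; rewrite big_nil inversions1 cards0; split.
have [s Ss Nsx] : exists2 s, s \in S & s \in N x.
  by apply: descent; rewrite ?genW.
have Ws := subsetP gens_sub _ Ss; have lsx := descent_length Ss Wx Nsx.
have [|//|c [Sc cE szc]] := IHn (s * x) _ _; rewrite -?lsx ?groupM //.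
exists (s :: c); split; last by rewrite /= szc lsx.
  by move=> r; rewrite inE => /predU1P[->|/Sc].
by rewrite big_cons -cE -{1}(gensV Ss) mulKg.
Qed.

Lemma card_inversions_word c : {subset c <= S} ->
  #|N (\prod_(s <- c) s)| <= size c.
Proof.
elim: c => [|s c IHc] Sc; first by rewrite big_nil inversions1 cards0.
have Ss : s \in S by rewrite Sc ?mem_head.
have Sc' : {subset c <= S} by move=> r cr; rewrite Sc // inE cr orbT.
have Wc : \prod_(s <- c) s \in W by rewrite -genW word_in.
rewrite big_cons; apply: leq_trans (card_inversionsM_le _ Wc) _.
  exact: (subsetP gens_sub).
by rewrite (NS Ss) cards1 add1n ltnS IHc.
Qed.

Lemma strong_exchange x t : x \in W -> t \in N x -> #|N (t * x)| < #|N x|.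
Proof.
case/reduced_word=> c [Sc -> <-] /(deletion Sc)[c' [c'c ltc' ->]].
by apply: leq_ltn_trans ltc'; apply: card_inversions_word => r /c'c/Sc.
Qed.

(** The tool by which conjugates of generators are later recognised as generators. *)
Lemma length1 J x : J \subset S -> x \in <<J>> -> x != 1 -> #|N x| <= 1 ->
  x \in J.
Proof.
move=> JS Jx ntx le1; have [s Js Nsx] := descent JS Jx ntx.
have Ss := subsetP JS _ Js; have Wx := subsetP (gen_subW JS) _ Jx.
have sx0 : N (s * x) = set0.
  by apply/eqP; rewrite -cards_eq0 -leqn0 -ltnS -descent_length.
have /inversions0/(_ sx0)/eqP : s * x \in W.
  by rewrite groupM // (subsetP gens_sub).
by rewrite -eq_invg_mul gensV // => /eqP <-.
Qed.

(** * Minimal coset representatives and inclusions of parabolics *)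

Lemma min_coset_rep J w : J \subset S -> w \in W ->
  exists2 v, v \in <<J>> & [disjoint <<J>> & N (v * w)].
Proof.
move=> JS Ww.
have [v Jv minv] := arg_minnP (fun v => #|N (v * w)|) (group1 <<J>>).
exists v => //; apply/pred0P=> t /=; apply/negP=> /andP[Jt Nt].
have Wv := subsetP (gen_subW JS) _ Jv.
have := minv (t * v) (groupM Jt Jv).
by rewrite leqNgt -mulgA strong_exchange ?groupM.
Qed.

Lemma inversions_coset J v y t :
    J \subset S -> v \in <<J>> -> y \in W -> [disjoint <<J>> & N y] ->
  (t \in N (v * y)) = (t \in N v) || (t ^ v \in N y).
Proof.
move=> JS Jv Wy dJy; rewrite NM // ?(subsetP (gen_subW JS)) //.
have [Nt | //] := boolP (t \in N v); rewrite (disjointFr dJy) //.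
by rewrite groupJ // (subsetP (inversions_sub_gen JS Jv)).
Qed.

Lemma card_inversions_coset J v y :
    J \subset S -> v \in <<J>> -> y \in W -> [disjoint <<J>> & N y] ->
  #|N (v * y)| = (#|N v| + #|N y|)%N.
Proof.
move=> JS Jv Wy dJy; apply: card_inversionsM => // [|t Nt].
  exact: (subsetP (gen_subW JS)).
rewrite (disjointFr dJy) // groupJ //.
exact: (subsetP (inversions_sub_gen JS Jv)).
Qed.


(* For x minimal in its double coset, conjugation by x preserves length on    *)
(* <<I>>, hence maps simple generators to simple generators.                  *)
Lemma parabolic_sub_eq I J w : I \subset S -> J \subset S -> w \in W ->
  <<I>> \subset <<J>> :^ w -> #|J| <= #|I| -> <<I>> = <<J>> :^ w.
Proof.
move=> IS JS Ww sIJ leJI; pose D := <<I>> :* w^-1 * <<J>>.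
have Dw : w^-1 \in D by rewrite -[w^-1]mulg1 mem_mulg ?group1 ?rcoset_refl.
have DM a x b : a \in <<I>> -> x \in D -> b \in <<J>> -> a * x * b \in D.
  move=> Ia /mulsgP[_ d /rcosetP[c Ic ->] Jd ->] Jb.
  have -> : a * (c * w^-1 * d) * b = a * c * w^-1 * (d * b) by rewrite !mulgA.
  by apply: mem_mulg; rewrite ?groupM // mem_rcoset mulgK groupM.
have [x Dx minx] := arg_minnP (fun x => #|N x|) Dw.
have Wx : x \in W.
  have /mulsgP[_ b /rcosetP[a Ia ->] Jb ->] := Dx.
  rewrite !groupM ?groupV //; first exact: subsetP (gen_subW IS) _ Ia.
  exact: subsetP (gen_subW JS) _ Jb.
have sIxJ : <<I>> :^ x \subset <<J>>.
  have /mulsgP[_ b /rcosetP[a Ia ->] Jb ->] := Dx.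
  by rewrite !conjsgM (conjGid Ia) -(conjGid Jb) conjSg sub_conjgV.
have dIx : [disjoint <<I>> & N x].
  apply/pred0P=> t /=; apply/negP=> /andP[It Nt].
  have /minx : t * x \in D by rewrite -[_ * x]mulg1 DM ?group1.
  by rewrite leqNgt strong_exchange.
have dJx : [disjoint <<J>> & N x^-1].
  apply/pred0P=> t /=; apply/negP=> /andP[Jt Nt].
  have Wt := subsetP (gen_subW JS) _ Jt.
  have /minx : x * t^-1 \in D by rewrite -[x]mul1g DM ?group1 ?groupV.
  rewrite leqNgt -(card_inversionsV Wx) -[#|N (x * _)|]card_inversionsV.
    by rewrite invMg invgK strong_exchange ?groupV.
  by rewrite groupM ?groupV.
(* For s in I, s x = x s^x; minimality of x on both sides makes the lengths add, so 1 + l(x) =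
   l(s^x) + l(x). *)
have IxJ : I :^ x = J.
  apply/eqP; rewrite eqEcard cardJg leJI andbT.
  apply/subsetP=> _ /imsetP[s Is ->].
  have Ss := subsetP IS _ Is; have Ws := subsetP gens_sub _ Ss.
  have Jsx : s ^ x \in <<J>> by rewrite (subsetP sIxJ) // memJ_conjg mem_gen.
  have Wsx : s ^ x \in W by rewrite groupJ.
  apply: (length1 JS Jsx); first by rewrite conjg_eq1 -order_gt1 oS.
  have := card_inversions_coset IS (mem_gen Is) Wx dIx.
  rewrite conjgC -[#|N (x * _)|](card_inversionsV (groupM Wx Wsx)) invMg.
  rewrite (card_inversions_coset JS) ?groupV // !card_inversionsV // (NS Ss).
  by rewrite cards1 => /addIn->.
by apply/setP/subset_cardP; rewrite // cardJg -IxJ genJ cardJg.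
Qed.

(** * Parabolics containing given reflections *)

Lemma longest_element J : J \subset S ->
  exists2 w, w \in <<J>> & N w = <<J>> :&: reflections W S.
Proof.
move=> JS; have [w Jw maxw] := arg_maxnP (fun w => #|N w|) (group1 <<J>>).
have Ww := subsetP (gen_subW JS) _ Jw.
exists w => //; apply/setP=> t; rewrite !inE; apply/idP/andP=> [Nt | [Jt Tt]].
  by rewrite (inversions_refl Ww) // (subsetP (inversions_sub_gen JS Jw)).
(* A reflection t of W_J missing from N w would be an inversion of t w, making t w longer than w. *)
apply: contraT => Nt; have Wt := subsetP (gen_subW JS) _ Jt.
have : #|N (t * w)| <= #|N w| by exact: maxw (groupM Jt Jw).
rewrite leqNgt.
have tt : t * t = 1.
  have /reflectionsP[x Wx Sx] := Tt.
  by rewrite -expg2 -(oS Sx) orderJ expg_order.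
rewrite -{1}[w]mul1g -tt -mulgA strong_exchange ?groupM //.
by rewrite NM // refl_inversion // conjg_self (negbTE Nt).
Qed.

(* The factorisations u = x y below cut u into the steps of a gallery of      *)
(* facets of type J, each step staying inside a parabolic of rank |J| + 1; t  *)
(* is crossed at one of the steps.                                            *)
Lemma parabolic_extend_gallery J u t : J \subset S -> u \in W ->
    J :^ u \subset S -> [disjoint <<J>> & N u] -> t \in N u ->
  exists K w, [/\ K \subset S, w \in W, #|K| <= #|J|.+1,
                  <<J>> \subset <<K>> :^ w & t \in <<K>> :^ w].
Proof.
have [n] := ubnP #|N u|; elim: n J u t => // n IHn J u t leun JS Wu JuS dJu Nt.
have ntu : u != 1 by apply: contraTneq Nt => ->; rewrite inversions1 inE.
have [s Ss Nsu] : exists2 s, s \in S & s \in N u.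
  by apply: descent; rewrite ?genW.
pose K := s |: J; have KS : K \subset S by rewrite subUset sub1set Ss.
have sJK : <<J>> \subset <<K>> by rewrite genS ?subsetUr.
have cardK : #|K| <= #|J|.+1 by rewrite cardsU1 -add1n leq_add2r leq_b1.
have [v Kv dKy] := min_coset_rep KS Wu; set y := v * u in dKy.
have Wv := subsetP (gen_subW KS) _ Kv; have Wy : y \in W by rewrite groupM.
pose x := v^-1; have Kx : x \in <<K>> by rewrite groupV.
have Wx : x \in W by rewrite groupV.
have uE : u = x * y by rewrite mulKg.
clearbody y.
have Nu r : (r \in N u) = (r \in N x) || (r ^ x \in N y).
  by rewrite uE (inversions_coset _ KS).
have [Nxt | Nxt] := boolP (t \in N x).
  exists K, 1; rewrite group1 conjsg1; split=> //.
  exact: subsetP (inversions_sub_gen KS Kx) _ Nxt.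
have Nyt : t ^ x \in N y by rewrite Nu (negbTE Nxt) in Nt.
have ntx : x != 1.
  apply: contraTneq Nsu => x1; rewrite uE x1 mul1g (disjointFr dKy) //.
  by rewrite mem_gen // setU11.
(* From j^x y = y j^u and the additivity of length over W_K y, l(j^x) + l(y) <= l(y) + 1. *)
have JxK : J :^ x \subset K.
  apply/subsetP=> _ /imsetP[j Jj ->].
  have Sj := subsetP JS _ Jj; have Sju : j ^ u \in S.
    by rewrite (subsetP JuS) // memJ_conjg.
  have Kjx : j ^ x \in <<K>> by rewrite groupJ // (subsetP sJK) // mem_gen.
  apply: (length1 KS Kjx); first by rewrite conjg_eq1 -order_gt1 oS.
  have := card_inversionsM_le Wy (subsetP gens_sub _ Sju).
  have jE : (j ^ x) ^ y = j ^ u by rewrite -conjgM -uE.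
  rewrite (NS Sju) -jE -conjgC (card_inversions_coset KS) // cards1.
  by rewrite addnC leq_add2l.
have lty : #|N y| < n.
  rewrite ltnS in leun; apply: leq_trans leun.
  rewrite uE (card_inversions_coset KS) // -add1n leq_add2r lt0n cards_eq0.
  by apply: contra ntx => /eqP/inversions0->.
have JxS := subset_trans JxK KS.
have [||K' [w [K'S Ww cardK' sK' tK']]] := IHn _ _ _ lty JxS Wy _ _ Nyt.
- by rewrite -conjsgM -uE.
- by apply: disjointWl dKy; apply: genS.
exists K', (w * x^-1); rewrite cardJg in cardK'; split=> //.
- by rewrite groupM ?groupV.
- by rewrite conjsgM -sub_conjg -genJ.
by rewrite conjsgM mem_conjgV.
Qed.

(** Unless t already lies in W_J, it is an inversion of u = w_J w_0, and u conjugates J into S, so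
    the gallery argument applies. *)
Lemma parabolic_extend J t : J \subset S -> t \in reflections W S ->
  exists K w, [/\ K \subset S, w \in W, #|K| <= #|J|.+1,
                  <<J>> \subset <<K>> :^ w & t \in <<K>> :^ w].
Proof.
move=> JS Tt; have [Jt | nJt] := boolP (t \in <<J>>).
  by exists J, 1; rewrite group1 conjsg1 leqnSn.
have [w0 Ww0 Nw0] := longest_element (subxx S).
have [wJ Jw NwJ] := longest_element JS.
have WwJ := subsetP (gen_subW JS) _ Jw; rewrite genW in Ww0 Nw0.
have Nu r : (r \in N (wJ * w0)) = (r \notin <<J>>) && (r \in reflections W S).
  rewrite NM // Nw0 NwJ !inE reflectionsJ //.
  have [Tr | _] := boolP (r \in reflections W S); last by rewrite !andbF.
  by rewrite (groupJ (subsetP reflections_sub _ Tr) WwJ) !andbT addbT.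
apply: (@parabolic_extend_gallery J (wJ * w0)); rewrite ?groupM //.
- apply/subsetP=> _ /imsetP[j Jj ->]; set u := wJ * w0 in Nu *.
  have Sj := subsetP JS _ Jj; have Wj := subsetP gens_sub _ Sj.
  have Wu : u \in W by rewrite groupM.
  clearbody u.
  apply: (length1 (subxx S)); rewrite ?genW ?groupJ //.
    by rewrite conjg_eq1 -order_gt1 oS.
  (* N u is stable under conjugation by j, so in N(u^-1 j u) the contributions of u^-1 and u cancel
     and only j^u is left. *)
  rewrite -(cards1 (j ^ u)); apply/subset_leq_card/subsetP=> t'.
  rewrite conjgE NM ?groupM ?groupV // inversionsV // mem_conjg NM // (NS Sj).
  rewrite !inE !Nu (reflectionsJ _ _ Wj) (groupJr _ (mem_gen Jj)).
  rewrite addbCA addbb addbF.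
  by move=> /eqP <-; rewrite -conjgE conjgKV.
- by apply/pred0P=> r /=; rewrite Nu; case: (r \in <<J>>).
by rewrite Nu nJt.
Qed.

Lemma reflections_in_parabolic (A : {set gT}) : A \subset reflections W S ->
  exists K w,
    [/\ K \subset S, w \in W, #|K| <= #|A| & <<A>> \subset <<K>> :^ w].
Proof.
have [n] := ubnP #|A|; elim: n A => // n IHn A leAn AT.
have [-> | [t At]] := set_0Vmem A.
  by exists set0, 1; rewrite sub0set group1 cards0 conjsg1.
have [||K [w [KS Ww leK sAK]]] := IHn (A :\ t).
- by rewrite (cardsD1 t A) At in leAn.
- by rewrite (subset_trans (subsetDl _ _) AT).
(* Conjugating by w^-1 brings the parabolic found for the other reflections to the standard W_K,
   which can then be extended. *)
have Tt : t ^ w^-1 \in reflections W S.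
  by rewrite reflectionsJ ?groupV ?(subsetP AT).
have [K' [w' [K'S Ww' leK' sKK' Kt]]] := parabolic_extend KS Tt.
exists K', (w' * w); rewrite groupM //; split=> //.
  by rewrite (cardsD1 t A) At add1n (leq_trans leK').
rewrite gen_subG -(setD1K At) subUset sub1set /= conjsgM.
rewrite -mem_conjg in Kt.
by rewrite Kt (subset_trans (subset_gen _)) // (subset_trans sAK) // conjSg.
Qed.

End Inversions.

(** * Comparison of two Coxeter systems on W *)

Section Parabolics.

Variables (gT : finGroupType) (W : {group gT}) (S : {set gT}).
Hypothesis coxS : coxeter_system W S.

Lemma coxeter_parabolic_sub_eq (I J : {set gT}) w :
    I \subset S -> J \subset S -> w \in W ->
  <<I>> \subset <<J>> :^ w -> #|J| <= #|I| -> <<I>> = <<J>> :^ w.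
Proof.
have [N [NS NM]] := inversions_exist coxS; have [genW oS _] := coxS.
exact: parabolic_sub_eq genW oS NS NM _ _ _.
Qed.

Lemma coxeter_reflections_in_parabolic (A : {set gT}) :
    A \subset reflections W S ->
  exists (K : {set gT}) w,
    [/\ K \subset S, w \in W, #|K| <= #|A| & <<A>> \subset <<K>> :^ w].
Proof.
have [N [NS NM]] := inversions_exist coxS; have [genW oS _] := coxS.
exact: reflections_in_parabolic genW oS NS NM _.
Qed.

End Parabolics.

(** Since S' generates W, the sign character of the class of s forces that class to meet S'; this
    makes the roles of S and S' symmetric. *)
Lemma generators_sub_reflections (gT : finGroupType) (W : {group gT})
    (S S' : {set gT}) :
    coxeter_system W S -> S' \subset reflections W S -> coxeter_system W S' ->
  S \subset reflections W S'.
Proof.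
move=> coxS S'T [genS' _ _]; apply/subsetP=> s Ss.
apply/reflectionsP.
exact: generating_reflections_meet_class coxS genS' S'T Ss.
Qed.

Lemma parabolics_sub (gT : finGroupType) (W : {group gT}) (S S' : {set gT}) :
    coxeter_system W S -> coxeter_system W S' ->
    S' \subset reflections W S -> S \subset reflections W S' ->
  parabolics W S' \subset parabolics W S.
Proof.
move=> coxS coxS' S'T ST'; apply/subsetP=> _ /imset2P[w I Ww IS' ->].
rewrite powersetE in IS'.
have ITS : I :^ w^-1 \subset reflections W S.
  apply/subsetP=> t; rewrite mem_conjgV => /(subsetP IS')/(subsetP S'T).
  by rewrite reflectionsJ.
have [K [v [KS Wv leK sIK]]] := coxeter_reflections_in_parabolic coxS ITS.
have KTS' : K :^ v \subset reflections W S'.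
  apply/subsetP=> t; rewrite mem_conjg => /(subsetP KS)/(subsetP ST').
  by rewrite reflectionsJ ?groupV.
have [L [u [LS' Wu leL sKL]]] := coxeter_reflections_in_parabolic coxS' KTS'.
rewrite !cardJg in leK leL; rewrite !genJ in sIK sKL.
(* Since |L| <= |K| <= |I|, the outer two parabolics of the chain agree, which squeezes the one
   generated by K between them. *)
have IL : <<I>> = <<L>> :^ (u * w).
  apply: (coxeter_parabolic_sub_eq coxS' IS' LS').
  - by rewrite groupM.
  - by rewrite conjsgM -sub_conjgV (subset_trans sIK).
  exact: leq_trans leL leK.
apply/imset2P; exists v^-1 K; rewrite ?groupV ?inE //.
apply/val_inj; rewrite /= invgK !genJ; apply/eqP; rewrite eqEsubset sIK /=.
by rewrite IL conjsgM conjsgK.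
Qed.

Theorem proposition1p4 (gT : finGroupType) (W : {group gT}) (S S' : {set gT})
    (coxS : coxeter_system W S)
    (S'T : S' \subset reflections W S)
    (coxS' : coxeter_system W S') :
  parabolics W S = parabolics W S'.
Proof.
have ST' := generators_sub_reflections coxS S'T coxS'.
by apply/eqP; rewrite eqEsubset !parabolics_sub.
Qed.
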